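(* For every infinite word $w$ over a finite alphabet and for every positive integer $n$, $$Qs_w(n) \leq C_w(n+1)-C_w(n)+1,$$ where $Qs_w(n)$ is the number of quasi-small circuits in the $n$-th Rauzy graph $\Gamma_n(w)$ of $w$, and $C_w(m)$ is the number of length-$m$ factors of $w$.
   Context: A factor of $w$ is a finite block of contiguous letters of $w$. $F_w(m)$ is the set of length-$m$ factors of $w$ and $C_w(m)=|F_w(m)|$. Rauzy graph: for a positive integer $l$, $\Gamma_l(w)$ is the oriented graph with vertex set $F_w(l)$ and edge set $F_w(l+1)$; an edge $e\in F_w(l+1)$ starts at $u$ and ends at $v$, where $u$ is the length-$l$ prefix and $v$ is the length-$l$ suffix of $e$. Circuits: a simple closed path in $\Gamma_l(w)$ is a sub-graph given, for some integer $j\ge 1$, by $j$ vertices $v_1,\dots,v_j$ and $j$ distinct edges $e_1,\dots,e_j$ such that $e_t$ goes from $v_t$ to $v_{t+1}$ for $1\le t\le j-1$ and $e_j$ goes from $v_j$ to $v_1$. It is an elementary circuit if the $j$ vertices are distinct; $j$ is then its size. Circuits are sub-graphs, i.e. identified by their vertex and edge sets (the choice of starting vertex is irrelevant). Words: two finite words $u,v$ are conjugate if $u=xy$, $v=yx$ for some words $x,y$; $[u]$ is the conjugacy class of $u$. A finite word is primitive if it is not a power $u^k$ ($k$ a natural number) of another word (in particular the empty word is not primitive). For a nonempty finite word $u$ and a positive rational $\alpha$ with $\alpha|u|$ an integer, $u^\alpha=u^a u_0$, where $a$ is the integer part of $\alpha$ and $u_0$ is the prefix of $u$ such that $|u^au_0|=\alpha|u|$;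 that is, $u^\alpha$ is the prefix of length $\alpha|u|$ of $uuu\cdots$. For a positive integer $m$, $[u]_m=\{v^{m/|v|} : v\in[u]\}$. Quasi-small circuits: a circuit in $\Gamma_l(w)$ is small if it is elementary and its size is at most $l$. It is primitive if it is elementary and there is a primitive factor $u$ of $w$ of length $l+1$ such that its vertex set is $[u]_l$ and its edge set is $[u]_{l+1}$. It is quasi-small if it is small or primitive. *)

(* Defs.v *)
From mathcomp Require Import all_boot all_order all_algebra.
From mathcomp Require Import boolp.

Set Implicit Arguments.
Unset Strict Implicit.
Unset Printing Implicit Defensive.

Section Digraph.
Variables V E : finType.

Record digraph := Digraph {
  vertices : {set V};
  edges : {set E};
  source : E -> V;
  target : E -> V
}.

(* A sub-graph is identified by its vertex set and its edge set. *)
Definition subgraph := ({set V} * {set E})%type.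

(* [ordS t] is [t + 1] modulo [j], so the last edge returns to the first
   vertex. *)
Definition traverses (G : digraph) (j : nat) (v : 'I_j -> V) (e : 'I_j -> E) :=
  [/\ forall t, v t \in vertices G,
      forall t, e t \in edges G,
      injective e
    & forall t, source G (e t) = v t /\ target G (e t) = v (ordS t)].

Definition simple_closed_path (G : digraph) (S : subgraph) : Prop :=
  exists j (v : 'I_j -> V) (e : 'I_j -> E),
    [/\ 0 < j, traverses G v e,
        S.1 = [set v t | t : 'I_j] & S.2 = [set e t | t : 'I_j]].

Definition elementary_circuit_of_size (G : digraph) (j : nat) (S : subgraph) :
    Prop :=
  exists (v : 'I_j -> V) (e : 'I_j -> E),
    [/\ 0 < j, traverses G v e, injective v,
        S.1 = [set v t | t : 'I_j] & S.2 = [set e t | t : 'I_j]].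

Definition elementary_circuit (G : digraph) (S : subgraph) : Prop :=
  exists j, elementary_circuit_of_size G j S.

Lemma elementary_circuit_simple G S :
  elementary_circuit G S -> simple_closed_path G S.
Proof. by case=> j [v [e [j0 Gve _ SV SE]]]; exists j, v, e. Qed.

End Digraph.

Section Words.
Variable A : finType.
Implicit Types (u v s : seq A) (w : nat -> A).

Definition conjugate u v : Prop := exists x y, u = x ++ y /\ v = y ++ x.

Definition word_exp u (k : nat) : seq A := flatten (nseq k u).

(* Taking [k = 0] shows that the empty word is not primitive. *)
Definition primitive_word s : Prop := forall u k, s = word_exp u k -> u = s.

(* The fractional power [u^(m / |u|)], indexed by its length [m] instead of by
   its exponent; [m %/ size u] is the integer part of the exponent. *)
Definition frac_power u (m : nat) : seq A :=
  word_exp u (m %/ size u) ++ take (m %% size u) u.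

(* [u]_m *)
Definition class_powers u (m : nat) : {set m.-tuple A} :=
  [set t : m.-tuple A | `[< exists2 v, conjugate u v & tval t = frac_power v m >]].

Definition factor_at w (m i : nat) : m.-tuple A := [tuple w (i + k) | k < m].

Definition factors w (m : nat) : {set m.-tuple A} :=
  [set t : m.-tuple A | `[< exists i, t = factor_at w m i >]].

Definition complexity w (m : nat) : nat := #|factors w m|.

Definition edge_prefix (l : nat) (e : l.+1.-tuple A) : l.-tuple A :=
  [tuple tnth e (widen_ord (leqnSn l) k) | k < l].

Definition edge_suffix (l : nat) (e : l.+1.-tuple A) : l.-tuple A :=
  [tuple tnth e (lift ord0 k) | k < l].

Definition rauzy w (l : nat) : digraph (l.-tuple A) (l.+1.-tuple A) :=
  Digraph (factors w l) (factors w l.+1) (@edge_prefix l) (@edge_suffix l).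

Definition rauzy_subgraph (l : nat) := subgraph (l.-tuple A) (l.+1.-tuple A).

Definition small_circuit w (l : nat) (S : rauzy_subgraph l) : Prop :=
  exists2 j, j <= l & elementary_circuit_of_size (rauzy w l) j S.

Definition primitive_circuit w (l : nat) (S : rauzy_subgraph l) : Prop :=
  elementary_circuit (rauzy w l) S /\
  exists u : l.+1.-tuple A,
    [/\ u \in factors w l.+1, primitive_word u,
        S.1 = class_powers u l & S.2 = class_powers u l.+1].

Definition quasi_small_circuit w (l : nat) (S : rauzy_subgraph l) : Prop :=
  small_circuit w S \/ primitive_circuit w S.

Definition num_quasi_small w (l : nat) : nat :=
  #|[set S : rauzy_subgraph l | `[< quasi_small_circuit w S >]]|.

End Words.

(* Main.v *)
Require Import Defs.
From mathcomp Require Import all_boot all_order all_algebra.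
From mathcomp Require Import boolp zify.

(** The quasi-small circuits are independent cycles of a connected graph, so
    there are at most as many of them as its cyclomatic number, which is
    [edges - vertices + 1].  Independence is proved by a triangularity argument
    for the lexicographic order on edges.

    Every quasi-small circuit is an elementary circuit of size at most [n + 1]
    ([quasi_small_size]).  Reading the first letters of the edges of a circuit
    of size [j] gives a [j]-periodic sequence whose windows of length [n + 1]
    are the edges of the circuit ([circuit_unroll]).  The key point is that a
    circuit of size at most [n + 1] is determined by its lexicographically
    least edge [e] ([least_edge_inj]).  Indeed, place the least edge at the
    beginning of the sequence: if the circuit has size [q <= n + 1], then [e]
    has no period [p] with [0 < p < q] ([least_window_period]; this is the fact
    that a Lyndon word has no border), so [q] is the least period of [e], and a
    [q]-periodic sequence is determined by its first [n + 1] letters.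

    Now remove from the Rauzy graph the least edge of each quasi-small circuit.
    The graph stays connected: by descending induction on the lexicographic
    order, the ends of a removed edge are joined by the rest of its circuit,
    which consists of larger edges ([cut_respects_edges]).  A connected graph
    has at most one more vertex than it has edges
    ([card_vertices_le_edges]), and exactly one edge was removed for each
    quasi-small circuit, whence the inequality.

    Connectedness is always expressed through cuts: a set of vertices that
    contains a base point and that no edge crosses contains all vertices.  This
    makes paths unnecessary. *)

Set Implicit Arguments.
Unset Strict Implicit.
Unset Printing Implicit Defensive.

Import Order.TTheory.

(** * Edges and vertices of a connected graph *)

(** This is the spanning tree bound.  A tree is grown from [r], one vertex and
    one edge at a time: as long as some vertex is missing, an edge of [T]
    crosses the boundary of the tree, and it is new because the edges of the
    tree have both ends inside. *)
Lemma card_vertices_le_edges (V E : finType) (G : digraph V E) (r : V)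
    (T : {set E}) :
    (forall X : {set V}, r \in X ->
       {in T, forall e, (source G e \in X) = (target G e \in X)} ->
       vertices G \subset X) ->
  #|vertices G| <= #|T|.+1.
Proof.
move=> conn.
have grow k : k < #|vertices G| -> exists (X : {set V}) (F : {set E}),
  [/\ r \in X, F \subset T, #|X| = k.+1, #|F| = k
    & {in F, forall e, (source G e \in X) && (target G e \in X)}].
  elim: k => [|k IHk] ltk.
    by exists [set r], set0; split=> [||||e];
      rewrite ?inE ?sub0set ?cards1 ?cards0.
  have [X [F [rX FT cX cF FX]]] := IHk (ltnW ltk).
  have [e eT crosses]: exists2 e, e \in T &
      (source G e \in X) != (target G e \in X).
    apply/exists_inP; apply: contraTT ltk => /exists_inPn noncross.
    rewrite -leqNgt -cX; apply/subset_leq_card/conn => // e /noncross.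
    by move/negPn/eqP.
  have eF : e \notin F.
    by apply: contra crosses => /FX/andP[-> ->].
  pose y := if source G e \in X then target G e else source G e.
  have yX : y \notin X.
    by rewrite /y; case: ifP crosses => [_|->//]; case: (target G e \in X).
  exists (y |: X), (e |: F); split.
  - by rewrite !inE rX orbT.
  - by rewrite subUset sub1set eT.
  - by rewrite cardsU1 yX cX.
  - by rewrite cardsU1 eF cF.
  - move=> f /setU1P[->|/FX/andP[sX tX]]; last by rewrite !inE sX tX !orbT.
    rewrite !inE /y; case: ifP crosses => [_|_]; first by rewrite eqxx orbT.
    by case: (target G e \in X) => //; rewrite eqxx orbT.
have [//|ltTV] := leqP #|vertices G| #|T|.+1.
have [X [F [_ FT _ cF _]]] := grow _ ltTV.
by have := subset_leq_card FT; rewrite cF ltnn.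
Qed.

(** A predicate on a cycle changes value an even number of times, so it cannot
    change at [t0] only. *)
Lemma ordS_invariant_but_one j (f : 'I_j -> bool) (t0 : 'I_j) :
  (forall t, t != t0 -> f t = f (ordS t)) -> f t0 = f (ordS t0).
Proof.
move=> inv.
have: \sum_t f t = \sum_t f (ordS t) by rewrite (reindex_inj (@ordS_inj j)).
rewrite (bigD1 t0) //= [RHS](bigD1 t0) //=.
rewrite [X in _ = _ + X](eq_bigr (fun t => f t : nat)); last first.
  by move=> t /inv ->.
by move/addIn; case: (f t0); case: (f _).
Qed.

(** * Least windows of a periodic sequence *)

Section Lexicographic.
Variables (d : Order.disp_t) (T : orderType d).
Implicit Types s t : seqlexi T.
Local Open Scope order_scope.

Lemma lexi_cat2l s t1 t2 :
  ((s ++ t1 : seqlexi T) <= s ++ t2) = (t1 <= t2 :> seqlexi T).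
Proof. by elim: s => //= x s IHs; rewrite lexi_cons lexx. Qed.

Lemma lexi_cat_prefix s1 s2 t1 t2 : size s1 = size s2 ->
  (s1 ++ t1 : seqlexi T) <= s2 ++ t2 -> s1 <= s2.
Proof.
elim: s1 s2 => [|x s1 IHs] [|y s2] //= [eqs].
rewrite !lexi_cons => /andP[-> /implyP leT] /=.
by apply/implyP => /leT/IHs->.
Qed.

End Lexicographic.

Definition window (T : Type) (c : nat -> T) i m : seq T :=
  [seq c k | k <- iota i m].

Lemma windowD T (c : nat -> T) i p q :
  window c i (p + q) = window c i p ++ window c (i + p) q.
Proof. by rewrite /window iotaD map_cat. Qed.

Lemma eq_windowP (T : Type) (c c' : nat -> T) i i' m :
  (forall k, k < m -> c (i + k) = c' (i' + k)) <->
  window c i m = window c' i' m.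
Proof.
elim: m i i' => [|m IHm] i i'; first by split.
split=> [eqc|[eq0 /IHm eqc] [|k] lek]; rewrite ?addn0 //.
  congr (_ :: _); first by have:= eqc 0 isT; rewrite !addn0.
  by apply/IHm => k ltk; rewrite !addSnnS eqc.
by rewrite -!addSnnS eqc.
Qed.

(** If a least window, at least as long as a period [q] of the sequence, had a
    shorter period [p], then it would recur [p] steps later.  With
    [r := q - p], the windows at [0] and [p] agree on their first [r] letters,
    and by [q]-periodicity the window at [p] then continues as the one at [0].
    Comparing the window at [0] with the one at [p] bounds the block of length
    [m - r] at [r] by the one at [0]; comparing it with the window at [r] gives
    the reverse bound, so all these comparisons are equalities. *)
Lemma least_window_period d (T : orderType d) (c : nat -> T) m p q :
    p < q <= m -> (forall i, c (i + q) = c i) ->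
    (forall i, (window c 0 m : seqlexi T) <= window c i m)%O ->
    (forall k, p + k < m -> c (p + k) = c k) ->
  window c p m = window c 0 m.
Proof.
move=> /andP[ltpq leqm] perq minc perp.
pose r := q - p.
have Em : m = r + (m - r) by lia.
have prefix0p : window c 0 r = window c p r.
  by apply/eq_windowP => k ltk; rewrite add0n perp //; lia.
have perW k : window c (p + r) k = window c 0 k.
  apply/eq_windowP => l _; rewrite add0n -(perq l).
  by congr c; lia.
have ler0 : ((window c r (m - r) : seqlexi T) <= window c 0 (m - r))%O.
  have := minc p; rewrite Em !windowD -prefix0p perW lexi_cat2l add0n.
  by rewrite -Em.
have le0r : ((window c 0 (m - r) : seqlexi T) <= window c r (m - r))%O.
  have := minc r; rewrite {1 2}Em addnC !windowD.
  by apply: lexi_cat_prefix; rewrite /window !size_map !size_iota.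
rewrite Em !windowD -prefix0p perW add0n; congr (_ ++ _).
by apply: (@le_anti _ (seqlexi T)); rewrite ler0 le0r.
Qed.

(** * Circuits of a Rauzy graph *)

Lemma val_iter_ordS j (t : 'I_j) i : iter i (@ordS j) t = (t + i) %% j :> nat.
Proof.
elim: i => [|i IHi] /=; first by rewrite addn0 modn_small.
by rewrite IHi -addn1 modnDml addn1 addnS.
Qed.

Section Circuits.
Variables (A : finType) (w : nat -> A) (n : nat).
Implicit Types (S : rauzy_subgraph A n) (e : n.+1.-tuple A).

(** The alphabet carries no order of its own; the enumeration of a finite type
    provides one. *)
Definition rank_word (s : seq A) : seqlexi 'I_#|A| := map enum_rank s.

Lemma rank_word_inj : injective rank_word.
Proof. exact/inj_map/enum_rank_inj. Qed.

Lemma rank_window (c : nat -> A) i m :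
  rank_word (window c i m) = window (enum_rank \o c) i m.
Proof. by rewrite /rank_word /window -map_comp. Qed.

(** Following an edge shifts a word by one letter, so the [k]-th letter of an
    edge is the first letter of the edge found [k] steps later: walking around
    the circuit from [e0] spells a periodic sequence whose windows are the
    edges.  The last clause records that the circuit does not close before [j]
    steps. *)
Lemma circuit_unroll S j e0 :
    elementary_circuit_of_size (rauzy w n) j S -> e0 \in S.2 ->
  exists c : nat -> A,
    [/\ forall i, c (i + j) = c i,
        forall e, e \in S.2 <-> exists i, val e = window c i n.+1,
        val e0 = window c 0 n.+1
      & forall i, 0 < i < j -> window c i n.+1 <> window c 0 n.+1].
Proof.
case=> v [e [j_gt0 [_ _ inje step] injv _ SE]]; rewrite SE => /imsetP[t0 _ ->].
pose at_ i := iter i (@ordS j) t0.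
pose c i := tnth (e (at_ i)) ord0.
have shift t (k : 'I_n) :
    tnth (e t) (lift ord0 k) = tnth (e (ordS t)) (widen_ord (leqnSn n) k).
  have [_ /= tgt] := step t; have [/= src _] := step (ordS t).
  have := congr1 (fun s => tnth s k) tgt; rewrite -src.
  by rewrite !tnth_mktuple.
have letter k (ltk : k < n.+1) i : tnth (e (at_ i)) (Ordinal ltk) = c (i + k).
  elim: k ltk i => [|k IHk] ltk i.
    by rewrite addn0 /c; congr tnth; apply: val_inj.
  rewrite addnS -addSn -(IHk (ltnW ltk)) -[at_ i.+1]/(ordS (at_ i)).
  have := shift (at_ i) (Ordinal (ltk : k < n)).
  by congr (_ = _); congr tnth; apply: val_inj.
have eW i : val (e (at_ i)) = window c i n.+1.
  apply: (@eq_from_nth _ (c 0)); first by rewrite size_tuple size_map size_iota.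
  move=> k; rewrite size_tuple => ltk; rewrite -(tnth_nth _ _ (Ordinal ltk)).
  by rewrite letter (nth_map 0) ?size_iota // nth_iota.
exists c; split=> [i|f||i /andP[i_gt0 ltij]].
- congr (tnth (e _) _); apply: val_inj; rewrite /at_ /=.
  by rewrite !val_iter_ordS addnA modnDr.
- split=> [/imsetP[t _ ->]|[i fW]].
    (* The number of steps from [t0] to [t], taken modulo [j]. *)
    exists (t + (j - t0)); rewrite -eW; congr (val (e _)); apply: val_inj => /=.
    rewrite /at_ val_iter_ordS addnCA subnKC 1?ltnW // modnDr modn_small //.
  by apply/imsetP; exists (at_ i) => //; apply: val_inj; rewrite fW eW.
- exact: (eW 0).
- rewrite -!eW => /val_inj/inje/(congr1 val).
  rewrite /at_ /= val_iter_ordS => Et0.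
  have: t0 + i = t0 + 0 %[mod j] by rewrite Et0 addn0 modn_small.
  by move/eqP; rewrite eqn_modDl mod0n modn_small //; lia.
Qed.

Definition least_edge S e : Prop :=
  e \in S.2 /\
  {in S.2, forall f : n.+1.-tuple A, (rank_word e <= rank_word f)%O}.

Lemma circuit_source_edges S j :
  elementary_circuit_of_size (rauzy w n) j S ->
  S.1 = [set edge_prefix e | e in S.2].
Proof.
case=> v [e [_ [_ _ _ step] _ -> ->]]; rewrite -imset_comp.
by apply: eq_imset => t /=; case: (step t) => /= <-.
Qed.

(** If the sizes differ, the least edge of the longer circuit also has the size
    of the shorter one as a period, which [least_window_period] forbids.  If
    they are equal, both periodic sequences are determined by the letters of
    [e], since [e] is at least as long as a period. *)
Lemma least_edge_inj S S' j j' e :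
    j <= n.+1 -> j' <= n.+1 ->
    elementary_circuit_of_size (rauzy w n) j S ->
    elementary_circuit_of_size (rauzy w n) j' S' ->
    least_edge S e -> least_edge S' e ->
  S = S'.
Proof.
move=> len len' circS circS' leastS leastS'.
wlog lejj' : S S' j j' len len' circS circS' leastS leastS' / j <= j'.
  move=> wl; have [|/ltnW] := leqP j j'; first exact: wl leastS leastS'.
  by move/wl => wl'; symmetry; apply: wl' leastS' leastS.
have j_gt0 : 0 < j by case: circS => ? [? []].
have [eS _] := leastS; have [eS' mine] := leastS'.
have [c [perc Sc ec _]] := circuit_unroll circS eS.
have [c' [perc' Sc' ec' distinct]] := circuit_unroll circS' eS'.
have eqc k : k < n.+1 -> c k = c' k.
  by have /eq_windowP := etrans (esym ec) ec'; apply.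
have mulper (a : nat -> A) q i :
    (forall i, a (i + q) = a i) -> a i = a (i %% q).
  move=> pera; rewrite {1}(divn_eq i q) addnC.
  by elim: (i %/ q) => [|k IHk]; rewrite ?addn0 // mulSn addnCA addnC pera.
have ltjj'F : j < j' -> False.
  move=> ltjj'; apply: (distinct j); first by rewrite j_gt0.
  apply: rank_word_inj; rewrite !rank_window.
  apply: (@least_window_period _ _ (enum_rank \o c') _ _ j') => [||i|k ltk] /=.
  - by rewrite ltjj'.
  - by move=> i; rewrite perc'.
  - have sz : size (window c' i n.+1) == n.+1 by rewrite size_map size_iota.
    rewrite -!rank_window -ec'.
    by apply: (mine (Tuple sz)); apply/Sc'; exists i.
  - by rewrite -!eqc 1?addnC ?perc //; lia.
have Ej : j' = j by apply/eqP; rewrite eqn_leq lejj' leqNgt andbT; apply/negP.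
subst j'.
have eqcc : c =1 c'.
  move=> i; rewrite (mulper c j) // (mulper c' j) // eqc //.
  by rewrite (leq_trans (ltn_pmod _ _)).
have eqW i : window c i n.+1 = window c' i n.+1 by apply/eq_windowP.
have ES2 : S.2 = S'.2.
  apply/setP => f; apply/idP/idP.
    by move=> /Sc[i fi]; apply/Sc'; exists i; rewrite fi eqW.
  by move=> /Sc'[i fi]; apply/Sc; exists i; rewrite fi eqW.
rewrite [S]surjective_pairing [S']surjective_pairing.
by rewrite (circuit_source_edges circS) (circuit_source_edges circS') ES2.
Qed.

(** The conjugates of a word of length [n + 1] are its [n + 1] rotations, and
    their powers of that length are themselves. *)
Lemma card_class_powers (u : n.+1.-tuple A) : #|class_powers u n.+1| <= n.+1.
Proof.
apply: (@leq_trans #|[set rot_tuple (i : 'I_n.+1) u | i : 'I_n.+1]|);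
  last first.
  by rewrite (leq_trans (leq_imset_card _ _)) ?cardT ?size_enum_ord.
apply/subset_leq_card/subsetP => t; rewrite inE => /asboolP[_ [x [y [Eu ->]]]].
have sz : size (y ++ x) = n.+1.
  by rewrite size_cat addnC -size_cat -Eu size_tuple.
rewrite /frac_power sz divnn modnn take0 cats0 /word_exp /= cats0 => Et.
have rot_x : rot (size x) u = y ++ x by rewrite Eu rot_size_cat.
have lex : size x <= n.+1 by rewrite -sz size_cat leq_addl.
(* The rotation by [n + 1] letters is the rotation by [0]. *)
apply/imsetP; case: (ltngtP (size x) n.+1) lex => // [ltx _|Ex _].
  by exists (Ordinal ltx) => //; apply: val_inj; rewrite /= rot_x.
exists ord0 => //; apply: val_inj => /=.
by rewrite rot0 Et -rot_x Ex rot_oversize // size_tuple.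
Qed.

Lemma quasi_small_size S : quasi_small_circuit w S ->
  exists2 j, j <= n.+1 & elementary_circuit_of_size (rauzy w n) j S.
Proof.
case=> [[j lej circ]|[[j circ] [u [_ _ _ Eu]]]]; exists j => //.
  exact: leqW.
have [v [e [_ [_ _ inje _] _ _ SE]]] := circ.
have <- : #|S.2| = j by rewrite SE card_imset // card_ord.
by rewrite Eu card_class_powers.
Qed.

Lemma exists_least_edge S j : elementary_circuit_of_size (rauzy w n) j S ->
  exists e, least_edge S e.
Proof.
case=> v [e [j_gt0 _ _ _ SE]].
have e0S : e (Ordinal j_gt0) \in S.2 by rewrite SE imset_f.
case: (arg_minP (fun f : n.+1.-tuple A => rank_word f) e0S) => f fS minf.
by exists f.
Qed.

(** Deleting the least edges [M] of some circuits does not disconnect the graph.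
    Otherwise, among the edges that cross the cut [X], consider the largest one,
    [e].  It is the least edge of a circuit whose other edges are larger and
    hence do not cross, but a circuit cannot cross a cut just once. *)
Lemma cut_respects_edges (M : {set n.+1.-tuple A}) (X : {set n.-tuple A}) :
    {in M, forall e, exists S j,
      elementary_circuit_of_size (rauzy w n) j S /\ least_edge S e} ->
    {in factors w n.+1 :\: M, forall e,
      (edge_prefix e \in X) = (edge_suffix e \in X)} ->
  {in factors w n.+1, forall e, (edge_prefix e \in X) = (edge_suffix e \in X)}.
Proof.
move=> leastM keepX e1 e1E; apply/eqP/negPn/negP => cut1.
pose cut e := (e \in factors w n.+1) &&
  ((edge_prefix e \in X) != (edge_suffix e \in X)).
have cut_e1 : cut e1 by rewrite /cut e1E.
have [e /andP[eE cute] maxe] :=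
  arg_maxP (fun f : n.+1.-tuple A => rank_word f) cut_e1.
have eM : e \in M.
  by apply: contraR cute => eM; rewrite keepX // inE eM.
have [S [j [[v [f [_ [_ fE injf step] _ _ SE]]] [eS mine]]]] := leastM e eM.
move: eS; rewrite SE => /imsetP[t0 _ Ee].
have [pre0 suf0] := step t0.
case/negP: cute; rewrite Ee; apply/eqP.
rewrite -[edge_prefix _]/(source (rauzy w n) _).
rewrite -[edge_suffix _]/(target (rauzy w n) _) pre0 suf0.
apply: (@ordS_invariant_but_one _ (fun t => v t \in X)) => t neqt.
have [pre suf] := step t; rewrite -suf -pre /=.
apply/eqP; apply: contraNT neqt => cutt; apply/eqP/injf.
have lef : (rank_word (f t) <= rank_word e)%O by apply: maxe; rewrite /cut fE.
have leE : (rank_word e <= rank_word (f t))%O by rewrite mine // SE imset_f.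
by rewrite -Ee; apply/val_inj/rank_word_inj/le_anti; rewrite lef leE.
Qed.

(** The successive factors of [w] form a walk that visits all vertices. *)
Lemma rauzy_connected (X : {set n.-tuple A}) :
    factor_at w n 0 \in X ->
    {in factors w n.+1, forall e,
      (edge_prefix e \in X) = (edge_suffix e \in X)} ->
  factors w n \subset X.
Proof.
move=> X0 keepX; apply/subsetP => _ /[!inE] /asboolP[i ->].
elim: i => [//|i IHi].
have iE : factor_at w n.+1 i \in factors w n.+1.
  by rewrite inE; apply/asboolP; exists i.
have pre : edge_prefix (factor_at w n.+1 i) = factor_at w n i.
  by apply: eq_from_tnth => k; rewrite !tnth_mktuple.
have suf : edge_suffix (factor_at w n.+1 i) = factor_at w n i.+1.
  by apply: eq_from_tnth => k; rewrite !tnth_mktuple /= /bump add1n addSnnS.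
by rewrite -suf -keepX // pre.
Qed.

End Circuits.

Theorem theorem2 (A : finType) (w : nat -> A) (n : nat) (hn : (0 < n)%N) :
  ((num_quasi_small w n)%:Z
     <= (complexity w n.+1)%:Z - (complexity w n)%:Z + 1)%R.
Proof.
rewrite /num_quasi_small; set Q := [set S | _].
have least S : exists e, S \in Q -> least_edge S e.
  have [|] := boolP (S \in Q); last by exists (factor_at w n.+1 0).
  rewrite inE => /asboolP/quasi_small_size[j _ /exists_least_edge[e leastS]].
  by exists e.
have [f least_f] := boolp.choice least.
have circQ S : S \in Q ->
    exists2 j, j <= n.+1 & elementary_circuit_of_size (rauzy w n) j S.
  by rewrite inE => /asboolP/quasi_small_size.
have injf : {in Q &, injective f}.
  move=> S S' QS QS' Ef.
  have [j lej circ] := circQ _ QS; have [j' lej' circ'] := circQ _ QS'.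
  apply: (least_edge_inj lej lej' circ circ' (least_f _ QS)).
  by rewrite Ef; apply: least_f.
pose M := [set f S | S in Q].
have ME : M \subset factors w n.+1.
  apply/subsetP => _ /imsetP[S QS ->]; have [fS _] := least_f _ QS.
  have [j _ [v [e [_ [_ eE _ _] _ _ SE]]]] := circQ _ QS.
  by move: fS; rewrite SE => /imsetP[t _ ->]; apply: eE.
have leV : #|factors w n| <= #|factors w n.+1 :\: M|.+1.
  apply: (@card_vertices_le_edges _ _ (rauzy w n) (factor_at w n 0)) =>
    X X0 keepX.
  apply: rauzy_connected X0 _; apply: cut_respects_edges keepX.
  move=> _ /imsetP[S QS ->]; have [j _ circ] := circQ _ QS.
  by exists S, j; split=> //; apply: least_f.
rewrite cardsD (setIidPr ME) card_in_imset // in leV.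
have leQ : #|Q| <= #|factors w n.+1|.
  by rewrite -(card_in_imset injf) subset_leq_card.
move: leV leQ; rewrite /complexity.
set V := #|factors w n|; set E := #|factors w n.+1|; set q := #|Q|; lia.
Qed.
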